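(* Let $L$ be a finite trim lattice, and let $\hat0=x_0\lessdot x_1\lessdot\cdots\lessdot x_n=\hat1$ be a maximal chain of left modular elements of $L$, where $L$ has exactly $n$ join-irreducibles and exactly $n$ meet-irreducibles. If $K$ is a sublattice of $L$ (closed under $\vee$ and $\wedge$) containing all the $x_i$, then $K$ is trim.
   Context: All lattices are finite. An element $x$ of a lattice $L$ is left modular if for all $y<z$ in $L$, $(y\vee x)\wedge z=y\vee(x\wedge z)$. A join-irreducible is an element that is not the minimum $\hat0$ and cannot be written as the join of two strictly smaller elements; a meet-irreducible is an element that is not the maximum $\hat1$ and cannot be written as the meet of two strictly larger elements. A lattice is trim if, for some $n$, it has a maximal chain of $n+1$ left modular elements and has exactly $n$ join-irreducibles and exactly $n$ meet-irreducibles. *)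

(* Defs.v *)
From HB Require Import structures.
From mathcomp Require Import all_boot all_order.

Set Implicit Arguments.
Unset Strict Implicit.
Unset Printing Implicit Defensive.

Import Order.TTheory.
Local Open Scope order_scope.

Section Trim.
Context {d : Order.disp_t} {L : finLatticeType d}.
Implicit Types x y z : L.

(* A finLatticeType has no distinguished bottom and top (and may be empty),
   so the minimum and the maximum are given by predicates. *)
Definition is_min x := [forall y, x <= y].
Definition is_max x := [forall y, y <= x].

Definition covers x y := (x < y) && ~~ [exists z, (x < z) && (z < y)].

Definition left_modular x :=
  forall y z, y < z -> (y `|` x) `&` z = y `|` (x `&` z).

Definition join_irreducible x :=
  ~~ is_min x && ~~ [exists y, exists z, [&& y < x, z < x & x == y `|` z]].

Definition meet_irreducible x :=
  ~~ is_max x && ~~ [exists y, exists z, [&& x < y, x < z & x == y `&` z]].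

Definition chain (C : {set L}) := [forall x in C, forall y in C, x >=< y].

Definition maximal_chain (C : {set L}) := maxset chain C.

End Trim.

Definition trim {d : Order.disp_t} (L : finLatticeType d) : Prop :=
  exists (n : nat) (C : {set L}),
    [/\ maximal_chain C,
        #|C| = n.+1,
        {in C, forall x, left_modular x},
        #|[set x : L | join_irreducible x]| = n
      & #|[set x : L | meet_irreducible x]| = n].

(* A latticeClosed predicate is a sublattice, possibly empty; this is its
   carrier type, equipped below with the order, meet and join of L. *)
Definition sublattice {d : Order.disp_t} {L : finLatticeType d}
  (K : latticeClosed L) := {x : L | x \in K}.

Section Sublattice.
Context {d : Order.disp_t} {L : finLatticeType d} (K : latticeClosed L).
HB.instance Definition _ := SubFinite.on (sublattice K).
HB.instance Definition _ :=
  [SubChoice_isSubLattice of sublattice K by <: with d].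
End Sublattice.

(* Main.v *)
Require Import Defs.
From mathcomp Require Import all_boot all_order.

Set Implicit Arguments.
Unset Strict Implicit.
Unset Printing Implicit Defensive.

Import Order.TTheory.
Local Open Scope order_scope.

(** Given a left modular maximal chain [x 0, .., x n], the join-irreducibles
    are exactly the minimal elements of the disjoint nonempty layers
    [{z | z <= x i.+1, ~ z <= x i}].  So there are [n] of them if and only if
    every layer has a least element, that is, is closed under meet; this last
    property passes to the sublattices containing the chain.
    Meet-irreducibles are handled by order duality. *)

(** Indexing by [nat] lets consecutive terms and the reversed chain be written [x i.+1] and
    [x (n - i)] without casts between ordinals; values beyond [n] are unconstrained. *)
Definition left_modular_chain {d : Order.disp_t} {L : finLatticeType d}
    (n : nat) (x : nat -> L) : Prop :=
  [/\ is_min (x 0), is_max (x n),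
      forall i, (i < n)%N -> covers (x i) (x i.+1)
    & forall i, (i <= n)%N -> left_modular (x i)].

Lemma ex_minimal {d : Order.disp_t} {L : finPOrderType d} (S : {set L}) (u : L) :
  u \in S ->
  exists2 m, m \in S & m <= u /\ forall w, w \in S -> w <= m -> w = m.
Proof.
move=> uS; pose D (z : L) := [set w | w <= z].
pose P z := (z \in S) && (z <= u).
(* Minimality is obtained from a principal down-set of least cardinality: a strictly smaller element
   would have a strictly smaller down-set. *)
have Pu : P u by rewrite /P uS /=.
case: (arg_minnP (fun z => #|D z|) Pu) => m /andP[mS mu] m_min.
exists m => //; split=> // w wS wm; apply/eqP; rewrite eq_le wm /=.
have DwDm : D w \subset D m.
  by apply/subsetP => t; rewrite !inE => /le_trans; apply.
have /eqP eD : D w == D m.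
  by rewrite eqEcard DwDm m_min // /P wS (le_trans wm).
by have: m \in D w by [rewrite eD inE]; rewrite inE.
Qed.

Section JoinIrreducibles.
Context {d : Order.disp_t} {L : finLatticeType d} (n : nat) (x : nat -> L).
Hypothesis x_chain : left_modular_chain n x.

Let layer (i : nat) := [set z | (z <= x i.+1) && ~~ (z <= x i)].

Let minimals (i : nat) :=
  [set z in layer i | [forall w, (w \in layer i) ==> (w <= z) ==> (w == z)]].

Let chain_le i j : (i <= j <= n)%N -> x i <= x j.
Proof.
have [_ _ cov _] := x_chain; elim: j => [|j IH].
  by rewrite leqn0 andbT => /eqP->.
case/andP; rewrite leq_eqVlt => /predU1P[-> //|ij] jn.
apply: (le_trans (IH _)); first by rewrite -ltnS ij ltnW.
by have /andP[/ltW] := cov _ jn.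
Qed.

Let minimalsP i m :
  reflect (m \in layer i /\ forall w, w \in layer i -> w <= m -> w = m)
          (m \in minimals i).
Proof.
rewrite [m \in minimals i]in_set; apply: (iffP andP) => -[mi m_min]; split=> //.
  by move=> w wi wm; move/forallP/(_ w): m_min; rewrite wi wm => /eqP.
by apply/forallP => w; apply/implyP => wi; apply/implyP => wm; rewrite (m_min w).
Qed.

Let ex_minimals i u : u \in layer i -> exists2 m, m \in minimals i & m <= u.
Proof.
by case/ex_minimal => m mi [mu m_min]; exists m => //; apply/minimalsP.
Qed.

Let minimals_gt0 i : (i < n)%N -> (0 < #|minimals i|)%N.
Proof.
have [_ _ cov _] := x_chain => /cov/andP[x_lt _].
have /ex_minimals[m mi _] : x i.+1 \in layer i by rewrite inE lexx lt_geF.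
by apply/card_gt0P; exists m.
Qed.

Let minimals_disjoint (i j : 'I_n) :
  i != j -> [disjoint minimals i & minimals j].
Proof.
(* If [k < l], all of layer [k] lies below [x k.+1 <= x l], and nothing below [x l] is in layer
   [l]. *)
have lt_disj (k l : 'I_n) z :
    (k < l)%N -> z \in minimals k -> z \in minimals l -> False.
  move=> kl; rewrite !in_set -!andbA => /and3P[zk _ _] /and3P[_ /negP + _].
  by apply; apply: (le_trans zk); apply: chain_le; rewrite kl ltnW.
move=> ij; rewrite disjoint_subset; apply/subsetP => z zi.
rewrite inE; apply/negP => zj.
by have [/lt_disj|/lt_disj|/val_inj/eqP] := ltngtP i j;
  [apply; eauto | apply; eauto | rewrite (negbTE ij)].
Qed.

(** Whatever is strictly below a minimal element of layer [i] has left the layer, so it lies below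
    [x i], and so do joins of such elements. *)
Let minimals_join_irreducible i m : m \in minimals i -> join_irreducible m.
Proof.
case/minimalsP; rewrite inE => /andP[m_le m_nle] m_min; apply/andP; split.
  by apply: contra m_nle => /forallP.
apply/negP => /existsP[u /existsP[v /and3P[um vm /eqP m_uv]]].
have below w : w < m -> w <= x i.
  move=> wm; apply/negPn/negP => w_nle.
  have /m_min/(_ (ltW wm)) w_m : w \in layer i.
    by rewrite inE w_nle (le_trans (ltW wm)).
  by rewrite w_m ltxx in wm.
by move/negP: m_nle; apply; rewrite m_uv leUx !below.
Qed.

(** Left modularity enters here. Let [x i.+1] be the first chain element above [z]. If some [w < z]
    were in layer [i], covering would force [w \/ x i = x i.+1], and left modularity of [x i] would
    give [z = w \/ (x i /\ z)], a join of two elements strictly below [z]. *)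
Let join_irreducible_minimal z :
  join_irreducible z -> exists i : 'I_n, z \in minimals i.
Proof.
have [/forallP x0 /forallP xn cov lmod] := x_chain => /andP[z_nmin z_irr].
have ex_le : exists k, z <= x k by exists n.
case: (ex_minnP ex_le) => -[|i] z_le i_min.
  by case/negP: z_nmin; apply/forallP => w; apply: le_trans (x0 w).
have i_lt_n : (i < n)%N by apply: i_min.
have z_nle : ~~ (z <= x i) by apply/negP => /i_min; rewrite ltnn.
exists (Ordinal i_lt_n); apply/minimalsP; split; first by rewrite inE z_le.
move=> w; rewrite inE => /andP[/= w_le w_nle]; rewrite le_eqVlt.
case/predU1P=> // wz.
have x_join : w `|` x i = x i.+1.
  have /andP[x_lt /existsPn no_mid] := cov _ i_lt_n.
  apply/eqP; move/(_ (w `|` x i)): no_mid; apply: contraR => neq.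
  rewrite !lt_neqAle neq leUr leUx w_le (ltW x_lt) !andbT.
  by rewrite eq_sym eq_joinr.
case/negP: z_irr; apply/existsP; exists w; apply/existsP; exists (x i `&` z).
rewrite wz -lmod 1?ltnW // x_join.
have /eqP-> : x i.+1 `&` z == z by rewrite eq_meetr.
by rewrite eqxx andbT lt_neqAle leIr andbT eq_meetr.
Qed.

(* The condition says that [x i] is meet-prime in the interval below
   [x i.+1], i.e. that the [i]-th layer is closed under meet. *)
Lemma card_join_irreducible :
  #|[set z : L | join_irreducible z]| = n <->
  (forall i u v, (i < n)%N -> u <= x i.+1 -> v <= x i.+1 ->
     u `&` v <= x i -> (u <= x i) || (v <= x i)).
Proof.
have -> : [set z : L | join_irreducible z] = \bigcup_(i < n) minimals i.
  apply/setP => z; rewrite inE; apply/idP/bigcupP => [|[i _]].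
    by case/join_irreducible_minimal => i; exists i.
  exact: minimals_join_irreducible.
rewrite -sum1_card partition_disjoint_bigcup //.
under eq_bigr do rewrite sum1_card.
(* Each of the [n] summands is at least 1, so the sum is [n] exactly when every layer has a single
   minimal element. *)
have [_ sum_eq] := leqif_sum (fun (i : 'I_n) (_ : true) =>
  leqif_eq (minimals_gt0 (ltn_ord i))).
rewrite sum1_card card_ord in sum_eq.
split=> [card_n i u v i_lt_n u_le v_le|prime_x].
  apply: contraTT; rewrite negb_or => /andP[u_nle v_nle].
  move: sum_eq; rewrite card_n eqxx => /esym/forallP/(_ (Ordinal i_lt_n)).
  rewrite /= eq_sym => /cards1P[m min_m].
  (* A unique minimal element of a finite set is its least element, hence a lower bound of [u] and
     [v] that is not below [x i]. *)
  have m_le w : w \in layer i -> m <= w.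
    by case/ex_minimals => m'; rewrite min_m inE => /eqP->.
  have : m \in minimals i by rewrite min_m inE.
  rewrite in_set [m \in _]in_set => /andP[/andP[_ m_nle] _].
  by apply: contra m_nle; apply: le_trans; rewrite lexI !m_le ?inE ?u_le ?v_le.
apply/esym/eqP; rewrite sum_eq; apply/forallP => -[i i_lt_n] /=.
rewrite eq_sym eqn_leq minimals_gt0 // andbT; apply/card_le1_eqP => m m'.
case/minimalsP=> mi m_min /minimalsP[m'i m'_min].
have mm'i : m `&` m' \in layer i.
  move: mi m'i; rewrite !inE => /andP[m_le m_nle] /andP[m'_le m'_nle].
  rewrite (le_trans (leIl _ _) m_le) /=.
  apply/negP => /(prime_x _ _ _ i_lt_n m_le m'_le).
  by rewrite (negbTE m_nle) (negbTE m'_nle).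
exact: etrans (esym (m'_min _ mm'i (leIr _ _))) (m_min _ mm'i (leIl _ _)).
Qed.

End JoinIrreducibles.

Lemma left_modular_chain_dual {d : Order.disp_t} {L : finLatticeType d}
    (n : nat) (x : nat -> L) :
  left_modular_chain n x ->
  left_modular_chain n (fun i => x (n - i)%N : L^d).
Proof.
case=> x_min x_max cov lmod; split.
- by rewrite subn0.
- by rewrite subnn.
- move=> i i_lt_n; have := cov (n - i.+1)%N; rewrite subnSK // => /(_ (leq_subr _ _)).
  case/andP=> x_lt no_mid; apply/andP; split=> //.
  by apply: contra no_mid => /existsP[z /andP[? ?]]; apply/existsP; exists z; apply/andP.
(* Left modularity is self-dual: exchanging meet with join and [y] with [z] gives the same identity
   read from right to left. *)
- move=> i _ y z zy; have := lmod (n - i)%N (leq_subr _ _) z y zy.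
  by rewrite [LHS]meetC [RHS]joinC joinC [X in _ = X `|` _]meetC => /esym.
Qed.

(** Dually, the condition makes [x i.+1] join-prime in the interval above [x i]. *)
Lemma card_meet_irreducible {d : Order.disp_t} {L : finLatticeType d}
    (n : nat) (x : nat -> L) :
  left_modular_chain n x ->
  #|[set z : L | meet_irreducible z]| = n <->
  (forall i u v, (i < n)%N -> x i <= u -> x i <= v ->
     x i.+1 <= u `|` v -> (x i.+1 <= u) || (x i.+1 <= v)).
Proof.
move=> /left_modular_chain_dual/card_join_irreducible dual_iff.
(* [join_irreducible] over [L^d] is convertible to [meet_irreducible] over [L]. *)
apply: (iff_trans dual_iff); split=> prime_x i u v i_lt_n.
  (* Reversal sends the cover from [x i] to [x i.+1] to the one with index [n - i.+1]. *)
  have := prime_x (n - i.+1)%N u v; rewrite subKn // subnSK // subKn ?(ltnW i_lt_n) //.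
  by apply; exact: leq_subr.
have := prime_x (n - i.+1)%N u v; rewrite subnSK //; apply.
exact: leq_subr.
Qed.

Theorem theorem3 (d : Order.disp_t) (L : finLatticeType d) (n : nat)
    (x : 'I_n.+1 -> L)
    (trimL : trim L)
    (x_min : is_min (x ord0))
    (x_covers : forall i j : 'I_n.+1, j = i.+1 :> nat -> covers (x i) (x j))
    (x_max : is_max (x ord_max))
    (x_maximal : maximal_chain [set x i | i : 'I_n.+1])
    (x_left_modular : forall i : 'I_n.+1, left_modular (x i))
    (card_join_irr : #|[set y : L | join_irreducible y]| = n)
    (card_meet_irr : #|[set y : L | meet_irreducible y]| = n)
    (K : latticeClosed L)
    (x_in_K : forall i : 'I_n.+1, x i \in K) :
  trim (sublattice K).
Proof.
(* For [k > n], [inord k] is a default index; only [k <= n] matters. *)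
pose xL k := x (inord k).
pose xK k : sublattice K := Sub (xL k) (x_in_K _).
have ord0E : inord 0 = ord0 :> 'I_n.+1 by apply/val_inj; rewrite /= inordK.
have ord_maxE : inord n = ord_max :> 'I_n.+1 by apply/val_inj; rewrite /= inordK.
have covL k : (k < n)%N -> covers (xL k) (xL k.+1).
  by move=> kn; apply: x_covers; rewrite !inordK // ltnW.
have chainL : left_modular_chain n xL.
  by split; rewrite ?/xL ?ord0E ?ord_maxE.
have chainK : left_modular_chain n xK.
  split.
  - by apply/forallP => z; rewrite leEsub /= /xL ord0E; apply: (forallP x_min).
  - by apply/forallP => z; rewrite leEsub /= /xL ord_maxE; apply: (forallP x_max).
  (* An element of [K] strictly between would also be one of [L]. *)
  - move=> k /covL/andP[x_lt no_mid]; apply/andP; split=> //.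
    apply: contra no_mid => /existsP[z /andP[? ?]].
    by apply/existsP; exists (val z); apply/andP.
  - move=> k _ y z yz; apply: val_inj; exact: x_left_modular.
have x_inj : injective x.
  have lt_x (i j : 'I_n.+1) : (i < j)%N -> x i < x j.
    case: j => j /=; elim: j => // j IH jn; rewrite ltnS leq_eqVlt.
    have /andP[x_lt _] : covers (x (Ordinal (ltnW jn))) (x (Ordinal jn)).
      exact: x_covers.
    case/predU1P=> [ij|ij].
      by have -> : i = Ordinal (ltnW jn) by exact: val_inj.
    exact: lt_trans (IH _ ij) x_lt.
  move=> i j xij; apply: val_inj; apply/eqP; rewrite eqn_leq.
  by apply/andP; split; rewrite leqNgt; apply/negP => /lt_x; rewrite xij ltxx.
exists n, [set xK i | i : 'I_n.+1].
have imK : [set val y | y in [set xK i | i : 'I_n.+1]] = [set x i | i : 'I_n.+1].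
  rewrite -imset_comp; apply: eq_imset => i /=.
  by rewrite /xL inord_val.
split.
- have [x_ch x_maxi] := maxsetP x_maximal.
  have xE i : val (xK (i : 'I_n.+1)) = x i by rewrite /= /xL inord_val.
  apply/maxsetP; split.
    apply/forall_inP => _ /imsetP[i _ ->]; apply/forall_inP => _ /imsetP[j _ ->].
    have := forall_inP (forall_inP x_ch (x i) (imset_f _ _)) (x j) (imset_f _ _).
    by rewrite !inE -!xE => /(_ isT isT).
  move=> C C_ch sub_C.
  (* A chain of [K] is also a chain of [L], so maximality in [L] suffices. *)
  have /x_maxi eq_C : chain [set val y | y in C].
    apply/forall_inP => _ /imsetP[y yC ->]; apply/forall_inP => _ /imsetP[z zC ->].
    exact: (forall_inP (forall_inP C_ch y yC) z zC).
  by apply: (imset_inj val_inj); rewrite imK eq_C // -imK imsetS.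
- by rewrite -(card_imset _ val_inj) imK card_imset // card_ord.
- by move=> _ /imsetP[i _ ->]; have [_ _ _] := chainK; apply; rewrite -ltnS.
(* Both primeness conditions quantify only universally over elements, so they restrict from [L] to
   [K], where meets and joins agree. *)
- apply/(card_join_irreducible chainK) => i u v.
  by move/(card_join_irreducible chainL): card_join_irr; apply.
- apply/(card_meet_irreducible chainK) => i u v.
  by move/(card_meet_irreducible chainL): card_meet_irr; apply.
Qed.
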